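(* Let $(\mathbb{Z},w,m)$ be a normalized linear graph supported on the infinite line $\mathbb{Z}$ which satisfies $\mathrm{CD}(0,D)$ for some $D<\infty$. Then there is a constant $c>0$ such that $w(n,n+1)=c$ for all $n\in\mathbb{Z}$.
   Context: A weighted graph $G=(V,E,w,m)$ is a connected, undirected, simple, locally finite graph $(V,E)$ with vertex weights $m:V\to(0,\infty)$ and symmetric edge weights $w:E\to(0,\infty)$, $w(x,y)=w(y,x)$ (with $w(x,y)=0$ if $x\not\sim y$). It is normalized if $m(x)=\sum_{y\sim x}w(x,y)$ for all $x\in V$. It is a linear graph if $V=\mathbb{Z}\cap I$ for a (bounded or unbounded) interval $I\subset\mathbb{R}$ and $E=\{\{n,n+1\}: n,n+1\in V\}$. The Laplacian is $\Delta f(x)=\frac1{m(x)}\sum_{y\sim x}w(x,y)(f(y)-f(x))$ for $f:V\to\mathbb{R}$. Set $\Gamma(f,g)=\frac12(\Delta(fg)-f\Delta g-g\Delta f)$, $\Gamma(f)=\Gamma(f,f)$, and $\Gamma_2(f)=\frac12\Delta\Gamma(f)-\Gamma(f,\Delta f)$. For $K\in\mathbb{R}$, $D\in(0,\infty]$ (with $1/\infty=0$) and $x\in V$, the condition $\mathrm{CD}(K,D,x)$ means $\Gamma_2(f)(x)\ge\frac1D(\Delta f(x))^2+K\,\Gamma(f)(x)$ for all $f:V\to\mathbb{R}$; $\mathrm{CD}(K,D)$ means that $\mathrm{CD}(K,D,x)$ holds for all $x\in V$. *)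

(* Defs.v *)
From HB Require Import structures.
From mathcomp Require Import all_boot all_order all_algebra.
From mathcomp Require Import all_classical all_reals.

Set Implicit Arguments.
Unset Strict Implicit.
Unset Printing Implicit Defensive.

Import Order.TTheory GRing.Theory Num.Theory.
Local Open Scope classical_set_scope.
Local Open Scope ring_scope.

(* The edge weight [w : E -> (0, oo)] is encoded as a symmetric function on
   pairs of vertices that is positive exactly on the edges and 0 elsewhere. *)
Record wgraph (R : realType) (V : choiceType) := WGraph {
  adj : rel V;
  wt : V -> V -> R;
  vwt : V -> R;
  adj_sym : symmetric adj;
  adj_irr : irreflexive adj;
  adj_connected : forall x y, exists2 p : seq V, path adj x p & last x p = y;
  adj_locally_finite : forall x, finite_set [set y | adj x y];
  vwt_gt0 : forall x, 0 < vwt x;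
  wt_sym : forall x y, wt x y = wt y x;
  wt_gt0 : forall x y, adj x y -> 0 < wt x y;
  wt_eq0 : forall x y, ~~ adj x y -> wt x y = 0
}.

Definition normalized (R : realType) (V : choiceType) (G : wgraph R V) : Prop :=
  forall x, vwt G x = \sum_(y \in [set y | adj G x y]) wt G x y.

(* Linear graph in the case V = Z (interval I = the whole real line). *)
Definition infinite_line (R : realType) (G : wgraph R int) : Prop :=
  forall m n : int, adj G m n = (n == m + 1) || (m == n + 1).

Section BakryEmery.
Context {R : realType} {V : choiceType} (G : wgraph R V).
Implicit Types (f g : V -> R) (x : V).

Definition laplacian f x : R :=
  (vwt G x)^-1 * \sum_(y \in [set y | adj G x y]) (wt G x y * (f y - f x)).

Definition Gamma f g x : R :=
  2^-1 * (laplacian (fun y => f y * g y) x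
          - f x * laplacian g x - g x * laplacian f x).

Definition Gamma2 f x : R :=
  2^-1 * laplacian (Gamma f f) x - Gamma f (laplacian f) x.

(* 1/D, with 1/oo = 0; only used for 0 < D <= +oo. *)
Definition dim_inv (D : \bar R) : R := if D is r%:E then r^-1 else 0.

Definition CD_at (K : R) (D : \bar R) x : Prop :=
  forall f, Gamma2 f x >= dim_inv D * laplacian f x ^+ 2 + K * Gamma f f x.

Definition CD (K : R) (D : \bar R) : Prop := forall x, CD_at K D x.

End BakryEmery.

(* Main.v *)
Require Import Defs.
From HB Require Import structures.
From mathcomp Require Import all_boot all_order all_algebra.
From mathcomp Require Import all_classical all_reals.
From mathcomp Require Import ring lra zify.

Set Implicit Arguments.
Unset Strict Implicit.
Unset Printing Implicit Defensive.

Import Order.TTheory GRing.Theory Num.Theory.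
Local Open Scope classical_set_scope.
Local Open Scope ring_scope.

(* Let p n, q n = 1 - p n be the probabilities of jumping right and left from n,
   and d n = p n - q n the drift; w is constant iff d = 0. Minimizing Gamma2 over
   f (n + 2) and f (n - 2) turns CD(0, D) at n into the nonnegativity of
     - p n d(n+1) a^2 + q n d(n-1) b^2 + al (p n a + q n b)^2,
   al = max (1/2, 1 - 2/D): enlarging D keeps al > 0, and al < 1 is where D < oo
   is used. Its determinant gives al (p n d(n-1) - q n d(n+1)) >= d(n-1) d(n+1).
   Hence a negative drift at n - 1 propagates to n + 1, and z = - 1 / d satisfies
     (1 - x n) z(n+1) + 2 / al <= (1 + x n) z(n-1),   x = - d.
   If x n <= 0 for the intermediate n, z decreases by at least 2 / al per step;
   otherwise two neighbouring drifts are negative, so are all later ones, and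
   z(n+1) (z n - 1) + z n > 0 decreases by at least 2 / al - 2 > 0 per step.
   Both are absurd. Positive drifts are excluded by reflecting the line. *)

Lemma pos_linear_decrease_absurd (R : archiRealFieldType) (e : R) (E : nat -> R) :
  0 < e -> (forall k, 0 < E k) -> (forall k, E k.+1 <= E k - e) -> False.
Proof.
move=> e0 E0 Edec.
have Ele k : E k <= E 0%N - k%:R * e.
  elim: k => [|k IHk]; first by rewrite mul0r subr0.
  by have := Edec k; rewrite -natr1; lra.
have lt0 : 0 <= E 0%N / e by rewrite divr_ge0 // ltW.
have := archi_boundP lt0; rewrite ltr_pdivrMr // => lt1.
have := Ele (Num.bound (E 0%N / e)); have := E0 (Num.bound (E 0%N / e)); lra.
Qed.

Lemma psd_form_det (R : realFieldType) (A B C : R) : 0 < C ->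
  (forall a b, 0 <= A * a ^+ 2 + B * b ^+ 2 + 2 * C * a * b) ->
  [/\ 0 < A, 0 < B & C ^+ 2 <= A * B].
Proof.
move=> C0 Q.
have A0 : 0 <= A by have := Q 1 0; lra.
have B0 : 0 <= B by have := Q 0 1; lra.
have Apos : 0 < A.
  rewrite lt_neqAle A0 andbT; apply/eqP => A00.
  (* If [A = 0], the form is affine in [a] at [b = 1], and this [a] gives it the value [-1]. *)
  have := Q (- (B + 1) / (2 * C)) 1; rewrite -A00.
  suff -> : 2 * C * (- (B + 1) / (2 * C)) * 1 = - (B + 1) by lra.
  by field; rewrite gt_eqF.
have AB : C ^+ 2 <= A * B.
  (* At [(- C, A)] the form equals [A] times its determinant. *)
  have : 0 <= A * (A * B - C ^+ 2) by have := Q (- C) A; nra.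
  by rewrite pmulr_rge0 // subr_ge0.
split=> //; have : 0 < A * B by apply: lt_le_trans AB; rewrite exprn_gt0.
by rewrite pmulr_rgt0.
Qed.

Section Drift.
(** [x k] stands for [d (n - k)] or for [- d (n + k)], so that one argument serves both directions
    of the line. *)
Context {R : realType} (al : R) (x : nat -> R).
Hypothesis al01 : 0 < al < 1.
Hypothesis x_bound : forall k, -1 < x k < 1.
Hypothesis x_diag : forall k, 0 < al * (1 - x k.+1) + 2 * x k.+2.
Hypothesis x_det : forall k,
  2 * x k * x k.+2 <= al * ((1 + x k.+1) * x k.+2 - (1 - x k.+1) * x k).

(** Collecting the terms of [x_det] with factor [x k] on the left leaves a product that [x_diag]
    makes positive. *)
Lemma drift_pos_step2 k : 0 < x k -> 0 < x k.+2.
Proof.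
move=> xk; have := x_det k; have := x_diag k.
have /andP[l1 u1] := x_bound k.+1; have /andP[al0 al1] := al01.
move=> dg dt; have : 0 < al * (1 + x k.+1) * x k.+2.
  apply: lt_le_trans (_ : x k * (al * (1 - x k.+1) + 2 * x k.+2) <= _); last lra.
  exact: mulr_gt0.
by rewrite pmulr_rgt0 // mulr_gt0 //; lra.
Qed.

(** This is [x_det] divided by [al * x k * x k.+2]. *)
Lemma drift_inv_step k : 0 < x k ->
  2 / al + (1 - x k.+1) / x k.+2 <= (1 + x k.+1) / x k.
Proof.
move=> xk; have xk2 := drift_pos_step2 xk; have /andP[al0 al1] := al01.
rewrite -subr_ge0.
have -> : (1 + x k.+1) / x k - (2 / al + (1 - x k.+1) / x k.+2) =
  (al * ((1 + x k.+1) * x k.+2 - (1 - x k.+1) * x k) - 2 * x k * x k.+2) /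
    (al * x k * x k.+2) by field; rewrite !gt_eqF.
apply: divr_ge0; first by rewrite subr_ge0.
by rewrite !mulr_ge0 // ltW.
Qed.

Lemma two_lt_2div_al : 2 < 2 / al.
Proof. by have /andP[? ?] := al01; rewrite ltr_pdivlMr //; lra. Qed.

Lemma no_consecutive_pos_drift k : 0 < x k -> x k.+1 <= 0.
Proof.
move=> xk; rewrite leNgt; apply/negP => xk1.
have xpos j : 0 < x (k + j)%N.
  suff : 0 < x (k + j)%N /\ 0 < x (k + j).+1 by case.
  elim: j => [|j [IH0 IH1]]; first by rewrite addn0.
  by rewrite addnS; split=> //; apply: drift_pos_step2.
pose z j := (x (k + j)%N)^-1.
have z1 j : 1 < z j.
  by have /andP[_ u] := x_bound (k + j); rewrite invf_gt1.
apply: (@pos_linear_decrease_absurd _ (2 / al - 2)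
  (fun j => z j.+1 * (z j - 1) + z j)).
- by rewrite subr_gt0 two_lt_2div_al.
- by move=> j; have := z1 j; have := z1 j.+1; nra.
move=> j.
have st := drift_inv_step (xpos j).
have xz : x (k + j).+1 = (z j.+1)^-1 by rewrite /z invrK addnS.
have zz2 : (x (k + j).+2)^-1 = z j.+2 by rewrite /z !addnS.
rewrite xz zz2 -/(z j) in st.
have z0 : 0 < z j.+1 by have := z1 j.+1; lra.
have {}st : 2 / al * z j.+1 + (z j.+1 - 1) * z j.+2 <= (z j.+1 + 1) * z j.
  move: (ler_wpM2l (ltW z0) st); apply: etrans; congr (_ <= _); field.
    by apply/andP; split; rewrite gt_eqF //; case/andP: al01.
  by rewrite gt_eqF.
(* The drop is at least [(2 / al - 2) * z j.+1], and [z j.+1 > 1]. *)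
have := two_lt_2div_al; have := z1 j.+1.
set c := 2 / al in st *; nra.
Qed.

Lemma drift_le0 k : x k <= 0.
Proof.
rewrite leNgt; apply/negP => xk.
have xpos j : 0 < x (k + j.*2)%N.
  elim: j => [|j IHj]; first by rewrite addn0.
  by rewrite doubleS !addnS; apply: drift_pos_step2.
apply: (@pos_linear_decrease_absurd _ 2 (fun j => (x (k + j.*2)%N)^-1)) => //.
  by move=> j; rewrite invr_gt0.
move=> j; have := drift_inv_step (xpos j).
(* A nonpositive middle drift makes the left coefficient at least 1 and the right one at most 1. *)
have x1 := no_consecutive_pos_drift (xpos j).
have := xpos j.+1; rewrite doubleS !addnS => xj2 st.
have i0 : 0 < (x (k + j.*2))^-1 by rewrite invr_gt0.
have i2 : 0 < (x (k + j.*2).+2)^-1 by rewrite invr_gt0.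
have := two_lt_2div_al; nra.
Qed.

End Drift.

Section Line.
Context {R : realType} (G : wgraph R int).
Hypotheses (Gline : infinite_line G) (Gnorm : normalized G).

Let p n := wt G n (n + 1) / vwt G n.
Let q n := wt G n (n - 1) / vwt G n.
Let d n := 2 * p n - 1.

Lemma line_sum (F : int -> R) n :
  \sum_(y \in [set y | adj G n y]) F y = F (n + 1) + F (n - 1).
Proof.
have -> : [set y | adj G n y] = [set n + 1] `|` [set n - 1].
  apply/seteqP; split=> y /=; rewrite Gline.
    by case/orP => /eqP h; [left | right; lia].
  by case=> ->; apply/orP; [left | right]; apply/eqP; lia.
by rewrite fsbigU //= ?fsbig_set1 // => y /= [-> h]; exfalso; lia.
Qed.

Lemma line_right_gt0 n : 0 < p n.
Proof. by rewrite divr_gt0 ?vwt_gt0 ?wt_gt0 // Gline eqxx. Qed.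

Lemma line_left_gt0 n : 0 < q n.
Proof. by rewrite divr_gt0 ?vwt_gt0 ?wt_gt0 // Gline subrK eqxx orbT. Qed.

Lemma line_prob n : q n = 1 - p n.
Proof.
have m0 : vwt G n != 0 by rewrite gt_eqF ?vwt_gt0.
apply/eqP; rewrite eq_sym subr_eq addrC -mulrDl.
by rewrite -(line_sum (wt G n)) -Gnorm divff.
Qed.

Lemma line_laplacian f n :
  laplacian G f n = p n * (f (n + 1) - f n) + (1 - p n) * (f (n - 1) - f n).
Proof.
rewrite /laplacian line_sum -line_prob /p /q mulrDr !mulrA.
by rewrite ![(vwt G n)^-1 * _]mulrC.
Qed.

Definition tent (n : int) (a b : R) (m : int) : R :=
  if n <= m then (m - n)%:~R * a else (n - m)%:~R * b.

(* Among functions with fixed values at n - 1, n, n + 1, the one continued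
   affinely to n - 2 and n + 2 minimizes Gamma2 at n. *)
Lemma line_Gamma2_tent n a b :
  let f := tent n a b in
  laplacian G f n = p n * a + (1 - p n) * b /\
  2 * Gamma2 G f n = p n * (1 - 2 * p (n + 1)) * a ^+ 2
    + (1 - p n) * (2 * p (n - 1) - 1) * b ^+ 2
    + (p n * a + (1 - p n) * b) ^+ 2.
Proof.
move=> f.
have f0 : f n = 0 by rewrite /f /tent lexx subrr mul0r.
have f1 : f (n + 1) = a.
  by rewrite /f /tent ifT; last lia; rewrite (_ : _ - n = 1) ?mul1r //; lia.
have f2 : f (n + 1 + 1) = 2 * a.
  by rewrite /f /tent ifT; last lia; rewrite (_ : _ - n = 2) //; lia.
have g1 : f (n - 1) = b.
  by rewrite /f /tent ifF; last lia; rewrite (_ : n - _ = 1) ?mul1r //; lia.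
have g2 : f (n - 1 - 1) = 2 * b.
  by rewrite /f /tent ifF; last lia; rewrite (_ : n - _ = 2) //; lia.
split; first by rewrite line_laplacian f0 f1 g1; ring.
rewrite /Gamma2 /Gamma !line_laplacian ?addrK ?subrK f0 f1 f2 g1 g2.
by field.
Qed.

Lemma line_CD_det (D : \bar R) : (0 < D < +oo)%E -> CD G 0 D ->
  exists2 al : R, 0 < al < 1 & forall n,
    [/\ 0 < al * (1 + d n) - 2 * d (n + 1), 0 < al * (1 - d n) + 2 * d (n - 1) &
      2 * d (n - 1) * d (n + 1) <=
        al * ((1 + d n) * d (n - 1) - (1 - d n) * d (n + 1))].
Proof.
case: D => [r| |]; rewrite ?ltxx ?andbF //= !lte_fin => /andP[r0 _] cd.
have ri : 0 < r^-1 by rewrite invr_gt0.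
pose al := Num.max (2^-1) (1 - 2 * r^-1).
have al0 : 0 < al by rewrite lt_max; apply/orP; left; lra.
have al1 : al < 1 by rewrite gt_max; apply/andP; split; lra.
have alr : 1 - 2 * r^-1 <= al by rewrite le_max lexx orbT.
exists al => [|n]; first by rewrite al0 al1.
have pn := line_right_gt0 n; have qn := line_left_gt0 n.
rewrite line_prob in qn.
have pq := mulr_gt0 pn qn.
have [] := @psd_form_det _ (p n * (al * p n - d (n + 1)))
  ((1 - p n) * (al * (1 - p n) + d (n - 1))) (al * (p n * (1 - p n))).
- exact: mulr_gt0.
- move=> a b; have [lf g2] := line_Gamma2_tent n a b.
  have := cd n (tent n a b); rewrite /dim_inv lf mul0r addr0 => le2.
  (* [CD] bounds the form with [1 - 2 / r] in place of [al]; this square makes up the difference. *)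
  have sq : 0 <= (al - (1 - 2 * r^-1)) * (p n * a + (1 - p n) * b) ^+ 2.
    by rewrite mulr_ge0 ?sqr_ge0 // subr_ge0.
  by rewrite /d; lra.
rewrite (pmulr_rgt0 _ pn) (pmulr_rgt0 _ qn) => u0 v0 det.
(* A factor [p n * (1 - p n)] cancels from the determinant; then [1 + d n = 2 * p n] gives the
   stated form. *)
have {}det : al ^+ 2 * (p n * (1 - p n)) <=
    (al * p n - d (n + 1)) * (al * (1 - p n) + d (n - 1)).
  by rewrite -(ler_pM2r pq); lra.
by split; rewrite /d in u0 v0 det *; lra.
Qed.

Lemma line_CD_balanced (D : \bar R) : (0 < D < +oo)%E -> CD G 0 D ->
  forall n, 2 * p n = 1.
Proof.
move=> D0 cd n; have [al al01 H] := line_CD_det D0 cd.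
have pb m : -1 < d m < 1.
  have := line_right_gt0 m; have := line_left_gt0 m.
  by rewrite line_prob /d => ? ?; apply/andP; split; lra.
have eS (k : nat) : n + k.+1%:Z = n + k%:Z + 1 by lia.
have eS' (k : nat) : n - k.+1%:Z = n - k%:Z - 1 by lia.
apply/eqP; rewrite eq_le; apply/andP; split.
(* Positive drifts are followed to the left, negative ones to the right. *)
- suff : d (n - 0%N%:Z) <= 0 by rewrite subr0 /d; lra.
  apply: (@drift_le0 _ al (fun k => d (n - k%:Z))) => // k.
    by have [] := H (n - k.+1%:Z); rewrite !eS' !subrK; lra.
  by have [_ _] := H (n - k.+1%:Z); rewrite !eS' !subrK; lra.
- suff : - d (n + 0%N%:Z) <= 0 by rewrite addr0 /d; lra.
  apply: (@drift_le0 _ al (fun k => - d (n + k%:Z))) => // k.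
  + by have := pb (n + k%:Z) => /andP[? ?]; apply/andP; split; lra.
  + by have [] := H (n + k.+1%:Z); rewrite !eS !addrK; lra.
  + by have [_ _] := H (n + k.+1%:Z); rewrite !eS !addrK; lra.
Qed.

End Line.

Theorem theorem1p2 (R : realType) (G : wgraph R int)
    (Gline : infinite_line G) (Gnorm : normalized G)
    (GCD : exists2 D : \bar R, (0 < D < +oo)%E & CD G 0 D) :
  exists2 c : R, 0 < c & forall n : int, wt G n (n + 1) = c.
Proof.
have [D D0 cd] := GCD.
have bal := line_CD_balanced Gline Gnorm D0 cd.
(* Zero drift at [n] means that its two edges have equal weight. *)
have step n : wt G n (n + 1) = wt G (n - 1) (n - 1 + 1).
  rewrite subrK (wt_sym G (n - 1)).
  have m0 := vwt_gt0 G n.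
  have mE : vwt G n = wt G n (n + 1) + wt G n (n - 1).
    by rewrite Gnorm line_sum.
  have := bal n; rewrite mulrA => /divr1_eq; rewrite mE; lra.
exists (wt G 0 (0 + 1)); first by rewrite wt_gt0 // Gline eqxx.
elim/int_rec => [//|k IHk|k IHk].
  by rewrite step -IHk; congr (wt G _ _); lia.
by rewrite -IHk [RHS]step; congr (wt G _ _); lia.
Qed.
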